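(* Let $G$ be a finite simple graph on at least three vertices. If $G$ is $11$-tough and $G$ is $(2P_2\cup P_1)$-free, then $G$ is Hamiltonian (i.e., $G$ contains a cycle through all of its vertices).
   Context: For a graph $G$, let $c(G)$ denote its number of connected components. The toughness of a noncomplete graph $G$ is $\tau(G)=\min\{|S|/c(G-S): S\subseteq V(G),\ c(G-S)\ge 2\}$, and $\tau(G)=\infty$ if $G$ is complete; $G$ is $t$-tough if $\tau(G)\ge t$. $P_n$ denotes the path on $n$ vertices, and $2P_2\cup P_1$ is the graph on five vertices consisting of the vertex-disjoint union of two edges and one isolated vertex. A graph $G$ is $R$-free if it contains no induced subgraph isomorphic to $R$. *)

(* Defs.v *)
From mathcomp Require Import all_boot.
Set Implicit Arguments. Unset Strict Implicit. Unset Printing Implicit Defensive.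

Definition simple_graph (T : finType) (e : rel T) : Prop :=
  symmetric e /\ irreflexive e.

Definition del_rel (T : finType) (e : rel T) (S : {set T}) : rel T :=
  fun x y => [&& x \notin S, y \notin S & e x y].

Definition comp_of (T : finType) (e : rel T) (S : {set T}) (x : T) : {set T} :=
  [set y in ~: S | connect (del_rel e S) x y].

Definition components (T : finType) (e : rel T) (S : {set T}) : {set {set T}} :=
  [set comp_of e S x | x in ~: S].

Definition ncomp (T : finType) (e : rel T) (S : {set T}) : nat :=
  #|components e S|.

(* G is t-tough (t a natural number; only t = 11 is used):
   tau(G) >= t, i.e. |S| >= t * c(G-S) whenever c(G-S) >= 2.
   For a complete graph no such S exists, matching tau = infinity. *)
Definition tough (T : finType) (e : rel T) (t : nat) : Prop :=
  forall S : {set T}, 2 <= ncomp e S -> t * ncomp e S <= #|S|.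

Definition has_induced_2P2_P1 (T : finType) (e : rel T) : Prop :=
  exists a b c d f : T,
    uniq [:: a; b; c; d; f] /\
    e a b /\ e c d /\
    ~~ e a c /\ ~~ e a d /\ ~~ e a f /\
    ~~ e b c /\ ~~ e b d /\ ~~ e b f /\
    ~~ e c f /\ ~~ e d f.

Definition free_2P2_P1 (T : finType) (e : rel T) : Prop :=
  ~ has_induced_2P2_P1 e.

Definition hamiltonian (T : finType) (e : rel T) : Prop :=
  exists s : seq T, [/\ uniq s, (forall x, x \in s) & cycle e s].

(* Main.v *)
(** Suppose [G] is not Hamiltonian, let [c] be a longest cycle, [x] a vertex off
    [c], [n] the order of [G].  Rerouting [c] through a component of [G - c] shows,
    with toughness and (2P2 u P1)-freeness, that [G - c] has no edge, and that [x]
    together with the successors of its neighbours is independent; hence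
    [12 (d(x) + 1) <= n].  Call a vertex small if its degree is below [5n/12].
    Small vertices not adjacent to [x] form an independent set, and every small
    neighbour of [x] is adjacent to all of it, since otherwise an edge far from the
    three vertices involved completes an induced 2P2 u P1.

    Two facts about Hamiltonian paths of [c + x] conclude.  First, such a path never
    has two big ends: rotating both ends at once produces two large anticomplete
    sets, each containing an edge, and with [x] an induced 2P2 u P1.  Second, by
    Posa's rotation lemma the set [A] of rotated ends satisfies
    [|N(A)| <= 3|A|] inside the path, whereas toughness gives [|N(I)| >= 11|I|] for
    an independent set [I]; so the ends cannot all be small non-neighbours of [x].
    If a successor of a neighbour of [x] is big, rotating the path from it to [x]
    yields too many small ends; otherwise a path with one big end has at least
    [d(x) + 1] small non-neighbours of [x], which the rotation at a small end
    adjacent to [x] maps injectively into the neighbours of [x]. *)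
Require Import Defs.
From mathcomp Require Import all_boot.
From mathcomp Require Import boolp zify.
Set Implicit Arguments. Unset Strict Implicit. Unset Printing Implicit Defensive.

(** * Sequences, paths and cycles *)

Section Sequences.
Variables (T : eqType).
Implicit Types (s t p q : seq T) (x y z : T).

Lemma next_cons_cat s x y t : uniq (s ++ x :: y :: t) ->
  next (s ++ x :: y :: t) x = y.
Proof.
move=> U; have := U; rewrite cat_uniq => /and3P[_ /hasPn sN _].
have xs : x \notin s by apply: sN; rewrite inE eqxx.
rewrite next_nth mem_cat inE eqxx orbT.
case: s U xs {sN} => [|a s] /= U xs; first by rewrite eqxx.
move: xs; rewrite inE negb_or => /andP[xa xs].
by rewrite eq_sym (negPf xa) index_cat (negPf xs) /= eqxx addn0 nth_cat
           ltnNge leqnSn /= subSnn.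
Qed.

Lemma prev_cons_cat s x y t : uniq (s ++ x :: y :: t) ->
  prev (s ++ x :: y :: t) y = x.
Proof. by move=> U; rewrite -[X in prev _ X](next_cons_cat U) prev_next. Qed.

Lemma split_interior (x0 : T) s y : y \in s -> y != head x0 s -> y != last x0 s ->
  exists t1 a b t2, s = t1 ++ [:: a; y; b] ++ t2.
Proof.
move=> /splitPr[]; case/lastP => [|t1 a] [|b t2] /=.
- by rewrite eqxx.
- by rewrite eqxx.
- by rewrite last_cat eqxx.
by move=> _ _; exists t1, a, b, t2; rewrite -cats1 -catA.
Qed.

(** The count over prefixes grows by at most one per entry, so it takes every intermediate value.
    This cuts a path where half of a neighbourhood has been met. *)
Lemma count_split (a : pred T) p m : m <= count a p ->
  exists i, count a (take i p) = m.
Proof.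
elim: p m => [|x p IH] m /=; first by rewrite leqn0 => /eqP->; exists 0.
case: m => [|m]; first by exists 0.
case ax: (a x) => /= lem.
  by have [i E] := IH m lem; exists i.+1; rewrite /= ax E.
by have [i E] := IH m.+1 lem; exists i.+1; rewrite /= ax E.
Qed.

Lemma head_rev (x0 : T) s : head x0 (rev s) = last x0 s.
Proof. by case/lastP: s => // s y; rewrite rev_rcons last_rcons. Qed.

Lemma last_rev (x0 : T) s : last x0 (rev s) = head x0 s.
Proof. by rewrite -head_rev revK. Qed.

Lemma rev_nilN s : (rev s != [::]) = (s != [::]).
Proof. by rewrite -!size_eq0 size_rev. Qed.

Lemma next_inj s : uniq s -> injective (next s).
Proof. by move/prev_next/can_inj. Qed.

Lemma prev_inj s : uniq s -> injective (prev s).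
Proof. by move/next_prev/can_inj. Qed.

Lemma prev_head (x0 : T) s : uniq s -> prev s (head x0 s) = last x0 s.
Proof.
case: s => // a t; case/lastP: t => [|t b] U; first by rewrite /= eqxx.
have := U; rewrite -(rot_uniq (size t).+1) -(prev_rot (size t).+1 U).
rewrite -cats1 -cat_cons (@rot_size_cat _ (a :: t)) last_cat /= => Ur.
exact: (@prev_cons_cat [::] b a t).
Qed.

(** The extra [rot 1] moves the cut to just after [x], so the two arcs end, rather than begin, at
    [y] and [x]. *)
Lemma rot_arcs s x y : uniq s -> x \in s -> y \in s -> x != y ->
  exists i p q, [/\ rot 1 (rot i s) = rcons p y ++ rcons q x,
    head y p = next s x & head x q = next s y].
Proof.
move=> U xs ys xy.
have [i p q _ _ E] := rot_to_arc U xs ys xy.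
have Ur : uniq (x :: p ++ y :: q) by rewrite -E rot_uniq.
have E1 : rot 1 (rot i s) = rcons p y ++ rcons q x.
  by rewrite E rot1_cons rcons_cat cat_rcons.
exists i, p, q; split=> //.
- rewrite -(next_rot i U) E; case: p {E E1} Ur => [|a p] Ur.
    by rewrite (@next_cons_cat [::] x y q).
  by rewrite (@next_cons_cat [::] x a (p ++ y :: q)).
- have Ur1 : uniq (rot i s) by rewrite rot_uniq.
  have Ur2 : uniq (rot 1 (rot i s)) by rewrite rot_uniq.
  rewrite -(next_rot i U) -(next_rot 1 Ur1).
  move: Ur2; rewrite E1 cat_rcons; case: (q) => [|a t] Ut /=.
    by rewrite next_cons_cat.
  by rewrite next_cons_cat.
Qed.

End Sequences.

Section Paths.
Variables (T : eqType) (e : rel T) (x0 : T).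
Hypothesis sym : symmetric e.
Implicit Types (s t p q : seq T).

Lemma sorted_cat_link s t : s != [::] -> t != [::] ->
  sorted e (s ++ t) = [&& sorted e s, e (last x0 s) (head x0 t) & sorted e t].
Proof. by case: s t => [|a s] [|b t] //= _ _; rewrite cat_path. Qed.

Lemma cycle_link s : s != [::] ->
  cycle e s = sorted e s && e (last x0 s) (head x0 s).
Proof. by case: s => //= a s _; rewrite rcons_path. Qed.

Lemma cycle_cat2 s t : s != [::] -> t != [::] -> cycle e (s ++ t) =
  [&& sorted e s, e (last x0 s) (head x0 t), sorted e t & e (last x0 t) (head x0 s)].
Proof.
case: s t => [|a s] [|b t] //= _ _.
by rewrite rcons_cat cat_path /= rcons_path.
Qed.

Lemma cycle_cat3 s t p : s != [::] -> t != [::] -> p != [::] ->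
  cycle e (s ++ t ++ p) =
  [&& sorted e s, e (last x0 s) (head x0 t), sorted e t, e (last x0 t) (head x0 p),
      sorted e p & e (last x0 p) (head x0 s)].
Proof.
case: s t p => [|a s] [|b t] [|d p] //= _ _ _.
by rewrite !(rcons_cat, cat_path) /= !(rcons_cat, cat_path) /= rcons_path.
Qed.

Lemma cycle_cat4 s t p q : s != [::] -> t != [::] -> p != [::] -> q != [::] ->
  cycle e (s ++ t ++ p ++ q) =
  [&& sorted e s, e (last x0 s) (head x0 t), sorted e t, e (last x0 t) (head x0 p),
      sorted e p, e (last x0 p) (head x0 q), sorted e q & e (last x0 q) (head x0 s)].
Proof.
case: s t p q => [|a s] [|b t] [|d p] [|f q] //= _ _ _ _.
by do 3 rewrite ?rcons_cat ?cat_path /=; rewrite rcons_path.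
Qed.

Lemma sorted_rev_sym s : sorted e (rev s) = sorted e s.
Proof. by rewrite rev_sorted; apply: eq_sorted => a b; rewrite sym. Qed.

End Paths.

(** * Toughness and independent sets *)

Ltac card_lia :=
  repeat match goal with
  | |- context [#|?A|] => generalize #|A|; intro
  end; clear; lia.

Lemma ex_notin (T : finType) (A : {set T}) : #|A| < #|T| -> exists x, x \notin A.
Proof.
move=> lt; have /card_gt0P[x] : 0 < #|~: A| by rewrite cardsCs setCK; lia.
by rewrite inE; exists x.
Qed.

Section Toughness.
Variables (T : finType) (e : rel T).
Hypotheses (sym : symmetric e) (irr : irreflexive e).
Implicit Types (A S I D : {set T}) (x y : T).

Definition nbr x : {set T} := [set y | e x y].
Definition nbrs A : {set T} := [set y | [exists x in A, e x y]].
Definition indep A := [forall x in A, forall y in A, ~~ e x y].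

Lemma indepP A : reflect {in A &, forall x y, ~~ e x y} (indep A).
Proof.
apply: (iffP forall_inP) => h x; last by move=> xA; apply/forall_inP=> y; apply: h.
by move=> y xA yA; move/forall_inP: (h x xA); apply.
Qed.

Lemma indep_in A x y : indep A -> x \in A -> y \in A -> ~~ e x y.
Proof. by move/indepP; apply. Qed.

Lemma indepU1 x A : indep A -> {in A, forall y, ~~ e x y} -> indep (x |: A).
Proof.
move=> /indepP iA xA; apply/indepP => y z; rewrite !inE.
move=> /orP[/eqP->|yA] /orP[/eqP->|zA]; rewrite ?irr ?xA //; last exact: iA.
by rewrite sym xA.
Qed.

Lemma indepS A (B : {set T}) : A \subset B -> indep B -> indep A.
Proof. by move=> /subsetP s /indepP iB; apply/indepP => x y /s xB /s; apply: iB. Qed.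

Lemma not_indepP A : ~~ indep A -> exists x y, [/\ x \in A, y \in A & e x y].
Proof.
rewrite negb_forall => /existsP[x]; rewrite negb_imply => /andP[xA].
rewrite negb_forall => /existsP[y]; rewrite negb_imply negbK => /andP[yA exy].
by exists x, y.
Qed.

Lemma del_rel_sym S : connect_sym (del_rel e S).
Proof.
by apply: sym_connect_sym => x y; rewrite /del_rel sym; case: (x \in S); case: (y \in S).
Qed.

Lemma leq_ncomp S D : D \subset ~: S ->
  {in D &, forall x y, connect (del_rel e S) x y -> x = y} -> #|D| <= ncomp e S.
Proof.
move=> sD h; rewrite /ncomp.
have injf : {in D &, injective (comp_of e S)}.
  move=> x y xD yD E; apply: h => //.
  have : y \in comp_of e S y by rewrite inE (subsetP sD _ yD) connect0.
  by rewrite -E inE => /andP[].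
rewrite -(card_in_imset injf); apply/subset_leq_card/subsetP => _ /imsetP[x xD ->].
by apply: imset_f; apply: (subsetP sD).
Qed.

Lemma connect_isolated S x y : nbr x \subset S ->
  connect (del_rel e S) x y -> y = x.
Proof.
move=> /subsetP sN /connectP[[|z p] //=]; rewrite /del_rel.
by case/andP=> /and3P[_ zS xz] _; rewrite sN ?inE in zS.
Qed.

Lemma nbrs_sub A x : x \in A -> nbr x \subset nbrs A.
Proof. by move=> xA; apply/subsetP => y; rewrite !inE => exy; apply/exists_inP; exists x. Qed.

Variable t : nat.
Hypothesis tG : tough e t.

Lemma tough_card S D : D \subset ~: S ->
  {in D &, forall x y, connect (del_rel e S) x y -> x = y} ->
  1 < #|D| -> t * #|D| <= #|S|.
Proof.
move=> sD h D2; have le := leq_ncomp sD h.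
by apply: leq_trans (tG (leq_trans D2 le)); rewrite leq_mul2l le orbT.
Qed.

(** Deleting [S] isolates each vertex of [I] and leaves [x] in a further component. Thanks to [x],
    the bound also covers a singleton [I]. *)
Lemma tough_isolated S I x : nbrs I \subset S -> [disjoint I & S] ->
  x \notin S -> x \notin I -> I != set0 -> t * #|I|.+1 <= #|S|.
Proof.
move=> sN dis xS xI I0.
have iso i y : i \in I -> connect (del_rel e S) i y -> y = i.
  by move=> iI; apply: connect_isolated; apply: subset_trans (nbrs_sub iI) sN.
have <- : #|x |: I| = #|I|.+1 by rewrite cardsU1 xI.
apply: tough_card.
- apply/subsetP => y; rewrite !inE => /orP[/eqP->//|yI].
  by rewrite (disjointFr dis yI).
- move=> y z; rewrite !inE => /orP[/eqP->|yI] /orP[/eqP->|zI] //.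
  + by rewrite del_rel_sym => /(iso _ _ zI).
  + by move=> /(iso _ _ yI).
  + by move=> /(iso _ _ yI).
- by rewrite cardsU1 xI ltnS card_gt0.
Qed.

(** Were [nbrs e I] smaller, some vertex would lie outside [nbrs e I :|: I], and [tough_isolated]
    would give even [t * #|I|.+1]. *)
Lemma tough_nbrs I : indep I -> I != set0 -> t.+1 * #|I| <= #|T| ->
  t * #|I| <= #|nbrs I|.
Proof.
move=> iI I0 le; rewrite leqNgt; apply/negP => lt.
have /ex_notin[x] : #|nbrs I :|: I| < #|T|.
  by have := cardsU (nbrs I) I; rewrite mulSn in le; lia.
rewrite inE negb_or => /andP[xN xI].
have : t * #|I|.+1 <= #|nbrs I|.
  apply: tough_isolated xN xI I0 => //.
  rewrite disjoint_subset; apply/subsetP => y yI; rewrite !inE.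
  by apply/exists_inP => -[z zI]; apply/negP; apply: (indepP _ iI).
by rewrite mulnS; lia.
Qed.

(** Deleting the complement of [I] leaves only isolated vertices. *)
Lemma tough_indep I : indep I -> 1 < #|I| -> t.+1 * #|I| <= #|T|.
Proof.
move=> iI I2; rewrite mulSn -(cardsC I) leq_add2l.
apply: tough_card I2; first by rewrite setCK.
move=> x y xI yI /connect_isolated-> //.
apply/subsetP => z; rewrite !inE => exz; apply/negP => zI.
by move: exz; apply/negP; apply: (indepP _ iI).
Qed.

End Toughness.

(** * Rotations of a path *)

Section Rotations.
Variables (T : finType) (e : rel T) (x0 : T).
Hypothesis sym : symmetric e.
Implicit Types (p q s : seq T).

(** Posa rotations with fixed head: the path edge between [s1] and [s2] is exchanged, and the head
    of [s2] becomes the new end. *)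
Inductive rotation p : seq T -> Prop :=
| rotation_refl : rotation p p
| rotation_step s1 s2 : rotation p (s1 ++ s2) -> s1 != [::] -> s2 != [::] ->
    e (last x0 s1) (last x0 s2) -> rotation p (s1 ++ rev s2).

Variable p : seq T.
Hypotheses (pN : p != [::]) (Up : uniq p) (sp : sorted e p).

Lemma rotationP q : rotation p q ->
  [/\ perm_eq q p, sorted e q & head x0 q = head x0 p].
Proof.
elim=> {q} [|s1 s2 _ [IHp IHs IHh] n1 n2 ee]; first by split.
have n2' : rev s2 != [::] by rewrite -size_eq0 size_rev size_eq0.
split.
- by rewrite -(permPr IHp) perm_cat2l perm_rev.
- move: IHs; rewrite !(sorted_cat_link e x0) // head_rev sorted_rev_sym // ee.
  by case/and3P=> -> _ ->.
- by rewrite -IHh; case: (s1) n1.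
Qed.

Definition rotation_ends : {set T} :=
  [set a | `[< exists2 q, rotation p q & last x0 q = a >]].

Lemma mem_rotation_ends q : rotation p q -> last x0 q \in rotation_ends.
Proof. by move=> rq; rewrite inE; apply/asboolP; exists q. Qed.

Lemma rotation_endsP a : a \in rotation_ends ->
  exists2 q, rotation p q & last x0 q = a.
Proof. by rewrite inE => /asboolP. Qed.

Lemma rotation_ends_succ q s1 y z s2 : rotation p q -> q = s1 ++ y :: z :: s2 ->
  e y (last x0 q) -> z \in rotation_ends.
Proof.
move=> rq E ey; rewrite E in rq ey.
have r : rotation p (rcons s1 y ++ rev (z :: s2)).
  apply: rotation_step; rewrite ?cat_rcons //; first by case: (s1).
  by move: ey; rewrite last_rcons last_cat.
by have := mem_rotation_ends r; rewrite last_cat rev_cons last_rcons.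
Qed.

Let A := rotation_ends.

(** Each rotation destroys one path edge, whose far endpoint becomes an end. Hence no edge at [y] is
    ever destroyed; reversal may only swap its two neighbours. *)
Lemma rotation_neighbours q y : rotation p q -> y \in p ->
  y \notin A -> next p y \notin A -> prev p y \notin A ->
  [set next q y; prev q y] = [set next p y; prev p y].
Proof.
move=> rq yp yA nA pA; elim: rq => {q} // s1 s2 r IH n1 n2 ee.
have r' := rotation_step r n1 n2 ee.
have [pe _ hd] := rotationP r; have [pe' _ _] := rotationP r'.
have U : uniq (s1 ++ s2) by rewrite (perm_uniq pe).
have U' : uniq (s1 ++ rev s2) by rewrite (perm_uniq pe').
(* [prev] is cyclic: before the head comes the last entry of [p], which is an end. *)
have yhd : y != head x0 p.
  apply: contraNneq pA => ->; rewrite prev_head //.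
  exact: mem_rotation_ends (rotation_refl p).
have yE : y \in s1 ++ s2 by rewrite (perm_mem pe).
have y2 : y != last x0 s2.
  apply: contraNneq yA => ->; have := mem_rotation_ends r.
  by rewrite last_cat; case: (s2) n2.
have y2' : y != head x0 s2.
  apply: contraNneq yA => ->; have := mem_rotation_ends r'.
  by rewrite last_cat; case: (s2) n2 => //= a t _; rewrite rev_cons last_rcons.
have y1 : y != head x0 s1 by move: yhd; rewrite -hd; case: (s1) n1.
(* Otherwise the head of [s2] becomes an end, while by induction it is a neighbour of [y] in [p]. *)
have y1' : y != last x0 s1.
  apply/eqP => yl; have nx : next (s1 ++ s2) y = head x0 s2.
    move: U; rewrite yl; case/lastP: (s1) n1 => // t b _.
    by case: (s2) n2 => // a s _; rewrite last_rcons cat_rcons => /next_cons_cat.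
  have : head x0 s2 \in [set next p y; prev p y] by rewrite -IH -nx set21.
  have hA : head x0 s2 \in A.
    have := mem_rotation_ends r'; rewrite last_cat.
    by case: (s2) n2 => //= a t _; rewrite rev_cons last_rcons.
  by rewrite !inE => /orP[] /eqP E; [move: nA | move: pA]; rewrite -E hA.
rewrite -IH; move: yE; rewrite mem_cat => /orP[] yi.
  have [t1 [a [b [t2 E]]]] := split_interior yi y1 y1'.
  move: U U'; rewrite E -!catA /= => U U'.
  rewrite (prev_cons_cat U) (prev_cons_cat U').
  rewrite -[_ ++ [:: a, y, b & _]]cat_rcons in U; rewrite -[_ ++ [:: a, y, b & _]]cat_rcons in U'.
  by rewrite -!(cat_rcons a) (next_cons_cat U) (next_cons_cat U').
have [t1 [a [b [t2 E]]]] := split_interior yi y2' y2.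
move: U U'; rewrite E !rev_cat /= -[rev [:: _; _; _]]/[:: b; y; a] -!catA /= !catA.
move=> U U'; rewrite (prev_cons_cat U) (prev_cons_cat U').
rewrite -[_ ++ [:: a, y, b & _]]cat_rcons in U; rewrite -[_ ++ [:: b, y, a & _]]cat_rcons in U'.
by rewrite -(cat_rcons a) -(cat_rcons b) (next_cons_cat U) (next_cons_cat U') setUC.
Qed.

(** On a path ending at [a], the successor of a neighbour [y] of [a] becomes an end. By
    [rotation_neighbours], [y] is thus an end or next to one in [p]. *)
Lemma rotation_ends_nbrs : #|nbrs e A :&: [set y in p]| <= 3 * #|A|.
Proof.
have sub : nbrs e A :&: [set y in p] \subset A :|: (prev p @: A :|: next p @: A).
  apply/subsetP => y; rewrite in_setI => /andP[].
  rewrite [y \in nbrs _ _]inE [y \in [set _ in _]]inE.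
  move=> /exists_inP[a aA eay] yp; rewrite in_setU; case: (boolP (y \in A)) => //= yA.
  case: (boolP (next p y \in A)) => [nA|nA].
    by rewrite in_setU -[y in y \in _](prev_next Up) imset_f.
  case: (boolP (prev p y \in A)) => [pA|pA].
    by rewrite in_setU -[y in y \in next p @: _](next_prev Up) imset_f ?orbT.
  have [q rq qa] := rotation_endsP aA.
  have N := rotation_neighbours rq yp yA nA pA.
  have [pe _ _] := rotationP rq.
  have Uq : uniq q by rewrite (perm_uniq pe).
  have yq : y \in q by rewrite (perm_mem pe).
  case/splitPr: q / yq rq qa N {pe} Uq => s1 [|z s2] rq qa N Uq.
    by rewrite last_cat /= in qa; rewrite qa aA in yA.
  have zA : z \in A.
    by apply: (rotation_ends_succ rq (erefl _)); rewrite qa sym.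
  have : z \in [set next p y; prev p y] by rewrite -N (next_cons_cat Uq) set21.
  by rewrite !inE => /orP[] /eqP E; [move: nA | move: pA]; rewrite -E zA.
apply: leq_trans (subset_leq_card sub) _.
have := cardsU A (prev p @: A :|: next p @: A).
have := cardsU (prev p @: A) (next p @: A).
have := leq_imset_card (prev p) A; have := leq_imset_card (next p) A.
by lia.
Qed.

End Rotations.

(** * Rerouting a longest cycle *)

(** The empty list and an edge, as a list of two vertices, count as cycles here, so a longest one
    always exists. *)
Definition longest_cycle (T : finType) (e : rel T) (c : seq T) :=
  [/\ uniq c, cycle e c & forall s, uniq s -> cycle e s -> size s <= size c].

Lemma ex_longest_cycle (T : finType) (e : rel T) : exists c, longest_cycle e c.
Proof.
pose P n := [exists s : n.-tuple T, uniq s && cycle e s].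
have P0 : exists n, P n by exists 0; apply/existsP; exists [tuple].
have Pm n : P n -> n <= #|T|.
  by case/existsP=> s /andP[us _]; rewrite -(size_tuple s) -(card_uniqP us) max_card.
case: (ex_maxnP P0 Pm) => n /existsP[s /andP[us cs]] mx.
exists s; split=> // s' us' cs'; rewrite size_tuple; apply: mx.
by apply/existsP; exists (in_tuple s'); rewrite us'.
Qed.

Ltac count_lia :=
  repeat match goal with
  | |- context [count ?a ?s] => generalize (count a s); intro
  end; clear; lia.

Section LongestCycle.
Variables (T : finType) (e : rel T) (x0 : T).
Hypotheses (sym : symmetric e) (irr : irreflexive e).
Variable c : seq T.
Hypothesis lc : longest_cycle e c.
Implicit Types (a b x y z : T) (r s : seq T).

Let C : {set T} := [set x in c].
Let Uc : uniq c. Proof. by case: lc. Qed.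

Lemma longest_cycle_extend r s : r != [::] -> uniq r -> {in r, forall x, x \notin c} ->
  perm_eq s (c ++ r) -> cycle e s -> False.
Proof.
move=> r0 Ur rc pe cs; case: lc => _ _ /(_ s _ cs).
rewrite (perm_size pe) (perm_uniq pe) cat_uniq Uc Ur andbT size_cat /=.
have -> : ~~ has (mem c) r by apply/hasPn => x /rc.
by move=> /(_ isT); case: (r) r0 => //= ? ? _; lia.
Qed.

Definition bypass r := [/\ r != [::], uniq r, sorted e r & {in r, forall x, x \notin c}].

(** Otherwise [r] could be inserted between [a] and its successor. *)
Lemma next_not_attached r a : bypass r -> a \in c ->
  e a (head x0 r) -> ~~ e (last x0 r) (next c a).
Proof.
move=> [r0 Ur sr rc] ac ea; apply/negP => eb.
have [i p E] := rot_to ac.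
have E1 : rot 1 (rot i c) = rcons p a by rewrite E rot1_cons.
have hd : next c a = head x0 (rcons p a).
  rewrite -(next_rot i Uc) E; have := Uc; rewrite -(rot_uniq i) E.
  by case: (p) => [|b t] U /=; rewrite ?eqxx.
have pn : rcons p a != [::] by case: (p).
have cy : cycle e (rcons p a) by rewrite -E1 !rot_cycle; case: lc.
apply: (@longest_cycle_extend r (rcons p a ++ r)) => //.
  by rewrite perm_cat2r -E1 !perm_rot.
move: cy; rewrite (cycle_link e x0) // (cycle_cat2 e x0) // sr last_rcons ea -hd eb.
by case/andP=> ->.
Qed.

Lemma arcs a b : a \in c -> b \in c -> a != b ->
  exists p q, [/\ perm_eq (rcons p b ++ rcons q a) c,
    sorted e (rcons p b), sorted e (rcons q a),
    head x0 (rcons p b) = next c a /\ head x0 (rcons q a) = next c b &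
    next (rcons p b ++ rcons q a) =1 next c].
Proof.
move=> ac bc ab; have [i [p [q [E h1 h2]]]] := rot_arcs Uc ac bc ab.
have cy : cycle e (rcons p b ++ rcons q a) by rewrite -E !rot_cycle; case: lc.
have pn : rcons p b != [::] by case: (p).
have qn : rcons q a != [::] by case: (q).
move: cy; rewrite (cycle_cat2 e x0) // => /and4P[sp _ sq _].
exists p, q; rewrite -h1 -h2 -E; split=> //.
- by rewrite !perm_rot.
- by split; [case: (p) | case: (q)].
- by move=> z; rewrite !next_rot ?rot_uniq.
Qed.

(** Otherwise the arc up to [b], then [r], then the other arc backwards from [a] close up through
    the edge between the two successors. *)
Lemma next_not_adjacent r a b : bypass r -> a \in c -> b \in c -> a != b ->
  e b (head x0 r) -> e (last x0 r) a -> ~~ e (next c a) (next c b).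
Proof.
move=> [r0 Ur sr rc] ac bc ab eb ea; apply/negP => ew.
have [p [q [pe sp sq [h1 h2] _]]] := arcs ac bc ab.
have pn : rcons p b != [::] by case: (p).
have qn : rcons q a != [::] by case: (q).
apply: (@longest_cycle_extend r (rcons p b ++ r ++ rev (rcons q a))) => //.
  move/permP: pe => pe; apply/permP => P.
  by rewrite !count_cat count_rev -pe count_cat; count_lia.
rewrite (cycle_cat3 e x0) ?rev_nilN // sorted_rev_sym // sp sq sr /=.
by rewrite head_rev last_rev !last_rcons h1 h2 eb ea sym ew.
Qed.

(** The cycle of [next_not_adjacent], with its closing edge replaced by a detour through [z]. *)
Lemma next_common_nbr r a b z : bypass r -> a \in c -> b \in c -> a != b ->
  e b (head x0 r) -> e (last x0 r) a -> z \notin c -> z \notin r ->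
  e z (next c a) -> ~~ e z (next c b).
Proof.
move=> [r0 Ur sr rc] ac bc ab eb ea zc zr eza; apply/negP => ezb.
have [p [q [pe sp sq [h1 h2] _]]] := arcs ac bc ab.
have pn : rcons p b != [::] by case: (p).
have qn : rcons q a != [::] by case: (q).
apply: (@longest_cycle_extend (z :: r) (rcons p b ++ r ++ rev (rcons q a) ++ [:: z])) => //.
- by rewrite /= zr.
- by move=> x; rewrite inE => /orP[/eqP->|/rc].
- move/permP: pe => pe; apply/permP => P.
  by rewrite -[z :: r]cat1s !count_cat count_rev -pe count_cat; count_lia.
rewrite (cycle_cat4 e x0) ?rev_nilN // sorted_rev_sym // sp sq sr /=.
by rewrite head_rev last_rev !last_rcons h1 h2 eb ea sym ezb eza.
Qed.

Lemma bypass_rev r : bypass r -> bypass (rev r).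
Proof.
move=> [r0 Ur sr rc]; split; rewrite ?rev_nilN ?rev_uniq ?sorted_rev_sym //.
by move=> x; rewrite mem_rev => /rc.
Qed.

(** The longer cycle runs from [b] back to [next c y], jumps to [next c a], goes forward to [y],
    jumps to [next c b], follows the other arc to [a] and returns to [b] through [r] reversed. *)
Lemma next_crossing_arc r a b p q y : bypass r ->
  e b (head x0 r) -> e (last x0 r) a -> perm_eq (rcons p b ++ rcons q a) c ->
  sorted e (rcons p b) -> sorted e (rcons q a) ->
  head x0 (rcons p b) = next c a -> head x0 (rcons q a) = next c b ->
  next (rcons p b ++ rcons q a) =1 next c ->
  y \in p -> e y (next c b) -> ~~ e (next c y) (next c a).
Proof.
move=> [r0 Ur sr rc] eb ea pe + sq h1 h2 nx yp eyb.
case/splitPr: p / yp pe h1 nx => p1 p2 pe h1 nx sp; apply/negP => ez.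
have zE : head x0 (rcons p2 b) = next c y.
  have := Uc; rewrite -nx -(perm_uniq pe) rcons_cat -catA /=.
  by case: (p2) => [|d t] U; rewrite next_cons_cat.
have pn1 : rcons p1 y != [::] by case: (p1).
have pn2 : rcons p2 b != [::] by case: (p2).
have qn : rcons q a != [::] by case: (q).
move: sp h1; rewrite rcons_cat rcons_cons -cat_rcons => sp h1.
have hp1 : head x0 (rcons p1 y) = next c a by rewrite -h1; case: (p1).
move: sp; rewrite (sorted_cat_link e x0) // => /and3P[sp1 _ sp2].
apply: (@longest_cycle_extend (rev r)
  (rev (rcons p2 b) ++ rcons p1 y ++ rcons q a ++ rev r)).
- by rewrite rev_nilN.
- by rewrite rev_uniq.
- by move=> x; rewrite mem_rev => /rc.
- move/permP: pe => pe; apply/permP => P.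
  by rewrite !count_cat !count_rev -pe rcons_cat rcons_cons -cat_rcons !count_cat !addnA; congr (_ + _ + _); exact: addnC.
rewrite (cycle_cat4 e x0) ?rev_nilN // !sorted_rev_sym // sp1 sp2 sq sr.
by rewrite !(head_rev, last_rev, last_rcons) zE hp1 h2 ez eyb sym ea sym eb.
Qed.

(** Depending on the arc that holds [y], two of the four edges give the crossing; the second arc is
    treated by exchanging [a] and [b] and reversing [r]. *)
Lemma next_crossing r a b y : bypass r -> a \in c -> b \in c -> a != b ->
  e b (head x0 r) -> e (last x0 r) a -> y \in c -> y != a -> y != b ->
  e y (next c a) -> e y (next c b) -> e (next c y) (next c a) ->
  ~~ e (next c y) (next c b).
Proof.
move=> br ac bc ab eb ea yc ya yb eya eyb eza; apply/negP => ezb.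
have [p [q [pe sp sq [h1 h2] nx]]] := arcs ac bc ab.
move: yc; rewrite -(perm_mem pe) mem_cat !mem_rcons !inE (negPf ya) (negPf yb) /=.
case/orP => yi.
  by move/negP: (next_crossing_arc br eb ea pe sp sq h1 h2 nx yi eyb).
have pe' : perm_eq (rcons q a ++ rcons p b) c by rewrite perm_catC.
have nx' : next (rcons q a ++ rcons p b) =1 next c.
  move=> z; by rewrite -nx -[rcons q a ++ _]rot_size_cat next_rot // (perm_uniq pe).
have eb' : e a (head x0 (rev r)) by rewrite head_rev sym.
have ea' : e (last x0 (rev r)) b by rewrite last_rev sym.
by move/negP: (next_crossing_arc (bypass_rev br) eb' ea' pe' sq sp h2 h1 nx' yi eya).
Qed.

End LongestCycle.

(** * Components off a longest cycle *)

(** Distinctness comes for free: any two of the five vertices are adjacent, or some vertex is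
    adjacent to exactly one of them. *)
Lemma free_no_2P2_P1 (T : finType) (e : rel T) a b c d f :
  symmetric e -> irreflexive e -> free_2P2_P1 e -> e a b -> e c d ->
  ~~ e a c -> ~~ e a d -> ~~ e b c -> ~~ e b d ->
  ~~ e a f -> ~~ e b f -> ~~ e c f -> ~~ e d f -> False.
Proof.
move=> sym irr free ab cd ac ad bc bd af bf cf df; apply: free.
exists a, b, c, d, f; do ![split=> //]; rewrite /= !inE !negb_or !andbT.
have neq x y : e x y -> x != y by apply: contraTneq => ->; rewrite irr.
have neqN x y z : e x z -> ~~ e y z -> x != y.
  by move=> xz; apply: contraNneq => <-.
rewrite (neq _ _ ab) (neq _ _ cd) (neqN _ _ b ab) 1?sym //.
rewrite (neqN _ _ b ab) 1?[e d b]sym // (neqN _ _ b ab) 1?[e f b]sym //.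
rewrite (neqN _ _ a) 1?[e b a]sym 1?[e c a]sym //.
rewrite (neqN _ _ a) 1?[e b a]sym 1?[e d a]sym //.
rewrite (neqN _ _ a) 1?[e b a]sym 1?[e f a]sym //.
rewrite (neqN _ _ d cd) 1?[e f d]sym //.
by rewrite (neqN _ _ c) 1?[e d c]sym 1?[e f c]sym.
Qed.

Section OffCycle.
Variables (T : finType) (e : rel T).
Hypotheses (sym : symmetric e) (irr : irreflexive e).
Hypotheses (tG : tough e 11) (free : free_2P2_P1 e).
Variable c : seq T.
Hypothesis lc : longest_cycle e c.
Implicit Types (a b x y z : T) (r s : seq T).

Let C : {set T} := [set x in c].
Let Uc : uniq c. Proof. by case: lc. Qed.

(** * A component off the cycle and its attachments *)

Section Component.
Variables (z : T).
Hypothesis zc : z \notin c.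
Let H := comp_of e C z.
Let X := [set a in c | [exists h in H, e a h]].
Let W := [set next c a | a in X].

Lemma comp_off x : x \in H -> x \notin c.
Proof. by rewrite !inE => /andP[]. Qed.

Lemma comp_closed x y : x \in H -> e x y -> y \notin c -> y \in H.
Proof.
rewrite !inE => /andP[xc cx] exy yc; rewrite yc /=; apply: connect_trans cx _.
by apply: connect1; rewrite /del_rel !inE xc yc.
Qed.

Lemma comp_self : z \in H.
Proof. by rewrite !inE zc connect0. Qed.

Lemma comp_bypass x y : x \in H -> y \in H ->
  exists r, [/\ bypass e c r, {subset r <= H}, head z r = x & last z r = y].
Proof.
move=> xH yH.
have : connect (del_rel e C) x y.
  move: xH yH; rewrite !inE => /andP[_ zx] /andP[_]; apply: connect_trans.
  by rewrite (del_rel_sym sym).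
move=> /connectP[p0 pp0 ->]; case/shortenP: pp0 => p pp Up _.
have sH : {subset x :: p <= H}.
  move=> u up; have cxy : connect (del_rel e C) x u by apply: path_connect pp _ _.
  have := xH; rewrite !inE => /andP[xc zx]; rewrite (connect_trans zx cxy) andbT.
  case/connectP: cxy => q; case/lastP: q => [|q b] pq ->; first by [].
  move: pq; rewrite rcons_path last_rcons => /andP[_].
  by rewrite /del_rel !inE => /and3P[].
exists (x :: p); split=> //; split=> //; last by move=> u /sH /comp_off.
by apply: (sub_path _ pp) => a b /and3P[].
Qed.

Lemma attached_bypass a b : a \in X -> b \in X ->
  exists r, [/\ bypass e c r, {subset r <= H}, e a (head z r) & e (last z r) b].
Proof.
rewrite !inE => /andP[ac /exists_inP[h hH eh]] /andP[bc /exists_inP[k kH ek]].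
have [r [br sr hr lr]] := comp_bypass hH kH.
by exists r; rewrite hr lr sym; split=> //; rewrite sym.
Qed.

Lemma attached_mem a : a \in X -> a \in c.
Proof. by rewrite inE => /andP[]. Qed.

Lemma next_attached a : a \in X -> next c a \notin X.
Proof.
move=> aX; apply/negP => nX.
have [r [br _ ea eb]] := attached_bypass aX nX.
by move/negP: (next_not_attached lc br (attached_mem aX) ea).
Qed.

Lemma nexts_indep : indep e W.
Proof.
apply/indepP => _ _ /imsetP[a aX ->] /imsetP[b bX ->].
have [->|ab] := eqVneq a b; first by rewrite irr.
have [r [br _ eb ea]] := attached_bypass bX aX.
by apply: (next_not_adjacent sym lc br) eb ea => //; exact: attached_mem.
Qed.

Lemma nexts_common y a b : a \in X -> b \in X -> a != b -> y \notin c -> y \notin H ->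
  e y (next c a) -> ~~ e y (next c b).
Proof.
move=> aX bX ab yc yH; have [r [br sr eb ea]] := attached_bypass bX aX.
apply: (next_common_nbr sym lc br) eb ea yc _ => //; try exact: attached_mem.
by apply: contra yH => /sr.
Qed.

Lemma nexts_crossing y a b : a \in X -> b \in X -> a != b -> y \in c -> y \notin X ->
  e y (next c a) -> e y (next c b) -> e (next c y) (next c a) ->
  ~~ e (next c y) (next c b).
Proof.
move=> aX bX ab yc yX; have [r [br sr eb ea]] := attached_bypass bX aX.
by apply: (next_crossing sym lc br) eb ea yc _ _ => //;
  try exact: attached_mem; apply: contraNneq yX => ->.
Qed.

Lemma nexts_mem w : w \in W -> [/\ w \in c, w \notin X & w \notin H].
Proof.
case/imsetP=> a aX ->; have wc : next c a \in c by rewrite mem_next attached_mem.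
by split=> //; [exact: next_attached | rewrite !inE wc].
Qed.

Lemma card_nexts : #|W| = #|X|.
Proof. by rewrite card_imset //; exact: next_inj. Qed.

Lemma component_nbrs : nbrs e H \subset H :|: X.
Proof.
apply/subsetP => y; rewrite inE => /exists_inP[h hH eh]; rewrite in_setU.
have [yc|yc] := boolP (y \in c); last by rewrite (comp_closed hH eh yc).
by rewrite [y \in X]inE yc /=; apply/orP; right; apply/exists_inP; exists h => //; rewrite sym.
Qed.

Hypothesis c0 : c != [::].

(** [X] separates [z] from any vertex of [c] outside [X], so two components remain, and [22] is
    [11 * 2]. *)
Lemma attached_card : 22 <= #|X|.
Proof.
have [w wc wX] : exists2 w, w \in c & w \notin X.
  case E: {1}c c0 => [//|b t] _; have bc : b \in c by rewrite E mem_head.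
  have [bX|bX] := boolP (b \in X); last by exists b.
  by exists (next c b); rewrite ?mem_next ?next_attached.
have inv p u : u \in H -> path (del_rel e X) u p -> last u p \in H.
  elim: p u => //= v p IH u uH /andP[/and3P[_ vX euv]]; apply: IH.
  have : v \in nbrs e H by rewrite inE; apply/exists_inP; exists u.
  by move/(subsetP component_nbrs); rewrite in_setU (negPf vX) orbF.
have wH : w \notin H by rewrite !inE wc.
have nc : ~~ connect (del_rel e X) z w.
  by apply: contra wH => /connectP[p pp ->]; apply: inv comp_self pp.
have zw : z != w by apply: contraNneq zc => ->.
have <- : 11 * #|[set z; w]| = 22 by rewrite cards2 zw.
apply: (tough_card tG); last by rewrite cards2 zw.
  apply/subsetP => y; rewrite in_set2 in_setC => /orP[] /eqP-> //.
  by rewrite inE (negPf zc).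
move=> u v; rewrite !in_set2 => /orP[] /eqP-> /orP[] /eqP-> //.
  by rewrite (negPf nc).
by rewrite (del_rel_sym sym) (negPf nc).
Qed.

(** An edge [z z'] would serve as one [P2] of the forbidden subgraph. This makes the rest [R] of the
    graph so rigid that [X :|: Y] violates toughness. *)
Lemma component_single z' : z' \notin c -> ~~ e z z'.
Proof.
move=> zc'; apply/negP => ezz.
have zH := comp_self; have zH' : z' \in H := comp_closed zH ezz zc'.
pose R := ~: (X :|: H).
have HR h u : h \in H -> u \in R -> ~~ e h u.
  move=> hH; rewrite in_setC; apply: contra => ehu.
  rewrite setUC; apply: (subsetP component_nbrs).
  by rewrite inE; apply/exists_inP; exists h.
(* Every edge inside [R] dominates [R]; an undominated [w] would complete the forbidden subgraph. *)
have dom u v w : e u v -> u \in R -> v \in R -> w \in R -> e u w || e v w.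
  move=> euv uR vR wR; apply/negPn; rewrite negb_or; apply/negP => /andP[uw vw].
  exact: (free_no_2P2_P1 sym irr free ezz euv (HR _ _ zH uR) (HR _ _ zH vR)
    (HR _ _ zH' uR) (HR _ _ zH' vR) (HR _ _ zH wR) (HR _ _ zH' wR) uw vw).
have WR w : w \in W -> w \in R.
  by move=> /nexts_mem[_ wX wH]; rewrite in_setC in_setU negb_or wX wH.
pose Y := [set y in R | [exists w in W, e w y]].
have YR y : y \in Y -> y \in R by rewrite inE => /andP[].
(* The edge [w0 y] dominates [w], and [w0] is not adjacent to [w]. *)
have Yall y w : y \in Y -> w \in W -> e w y.
  rewrite inE => /andP[yR /exists_inP[w0 w0W ewy]] wW; apply/negPn/negP => nwy.
  move: (dom _ _ w ewy (WR _ w0W) yR (WR _ wW)).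
  by rewrite (negPf (indep_in nexts_indep w0W wW)) sym (negPf nwy).
pose R1 := R :\: Y.
have [a [b [aX bX ab]]] : exists a b, [/\ a \in X, b \in X & a != b].
  by apply/card_gt1P; have := attached_card; lia.
have aW : next c a \in W by apply: imset_f.
have bW : next c b \in W by apply: imset_f.
have YN w y : w \in W -> y \in R1 -> ~~ e w y.
  rewrite in_setD => wW /andP[yY yR]; apply: contra yY => ewy.
  by rewrite inE yR; apply/exists_inP; exists w.
have R1R y : y \in R1 -> y \in R by rewrite in_setD => /andP[].
(* An edge inside [R1] would dominate [W], where [R1] has no neighbours. *)
have iR1 : indep e R1.
  apply/indepP => u v uR vR; apply/negP => euv.
  move: (dom _ _ (next c a) euv (R1R _ uR) (R1R _ vR) (WR _ aW)).
  by rewrite ![e _ (next c a)]sym (negPf (YN _ _ aW uR)) (negPf (YN _ _ aW vR)).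
have WR1 : W \subset R1.
  apply/subsetP => w wW; rewrite in_setD WR // andbT inE negb_and; apply/orP; right.
  by apply/exists_inP => -[v vW]; apply/negP; apply: (indep_in nexts_indep).
have zXY : z \notin X :|: Y.
  rewrite in_setU negb_or [z \in X]inE (negPf zc); apply/negP => /YR.
  by rewrite in_setC in_setU zH orbT.
have t1 : 11 * #|R1|.+1 <= #|X :|: Y|.
  apply: (tough_isolated sym tG _ _ zXY).
  - apply/subsetP => y; rewrite inE => /exists_inP[r rR ery].
    have [yR|] := boolP (y \in R).
      rewrite in_setU; apply/orP; right; apply/negPn/negP => yY.
      have yR1 : y \in R1 by rewrite in_setD yY.
      by move/negP: (indep_in iR1 rR yR1).
    rewrite in_setC negbK !in_setU => /orP[->//|yH].
    by move/negP: (HR y r yH (R1R _ rR)); rewrite sym.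
  - rewrite disjoints_subset; apply/subsetP => y yR1; rewrite in_setC in_setU negb_or.
    move: yR1; rewrite in_setD in_setC in_setU negb_or => /and3P[yY yX _].
    by rewrite yX.
  - by rewrite in_setD in_setC in_setU zH orbT /= andbF.
  - by apply/set0Pn; exists (next c a); apply: (subsetP WR1).
have Yc y : y \in Y -> y \in c.
  move=> yY; apply/negPn/negP => yc; have := YR _ yY.
  rewrite in_setC in_setU negb_or => /andP[_ yH].
  have eya : e y (next c a) by rewrite sym Yall.
  by have := nexts_common aX bX ab yc yH eya; rewrite sym Yall.
(* Consecutive [y] and [next c y] in [Y] would both be adjacent to all of [W], against
   [nexts_crossing]. *)
have t3 : [set next c y | y in Y] \subset X :|: R1.
  apply/subsetP => _ /imsetP[y yY ->]; rewrite in_setU.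
  case: (boolP (next c y \in X)) => //= nX; rewrite in_setD in_setC in_setU (negPf nX).
  have nc : next c y \in c by rewrite mem_next Yc.
  have nH : next c y \notin H by rewrite !inE nc.
  rewrite (negPf nH) andbT; apply/negP => nY.
  have yX : y \notin X.
    by have := YR _ yY; rewrite in_setC in_setU negb_or => /andP[].
  have ey u : u \in W -> e y u by move=> uW; rewrite sym Yall.
  have en u : u \in W -> e (next c y) u by move=> uW; rewrite sym Yall.
  have := nexts_crossing aX bX ab (Yc _ yY) yX (ey _ aW) (ey _ bW) (en _ aW).
  by rewrite en.
(* Now [#|Y| <= #|X| + #|R1|] and [#|X| = #|W| <= #|R1|], so [#|X :|: Y| <= 3 * #|R1|], against
   [t1]. *)
have := subset_leq_card t3; rewrite (card_imset _ (next_inj Uc)).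
have := subset_leq_card WR1; rewrite card_nexts.
have := cardsU X R1; have := cardsU X Y; move: t1; card_lia.
Qed.

End Component.

End OffCycle.

(** * A vertex off a longest cycle *)

Section LowDegree.
Variables (T : finType) (e : rel T).
Hypotheses (sym : symmetric e) (irr : irreflexive e).
Hypotheses (tG : tough e 11) (free : free_2P2_P1 e) (T3 : 3 <= #|T|).
Variable c : seq T.
Hypothesis lc : longest_cycle e c.
Implicit Types (a b x y z : T) (r s : seq T) (A B : {set T}).

Let C : {set T} := [set x in c].
Let Uc : uniq c. Proof. by case: lc. Qed.

(** An edge already counts as a cycle, so otherwise all vertices together would be independent. *)
Lemma longest_cycle_neq0 : c != [::].
Proof.
apply/eqP => c0; have noe a b : ~~ e a b.
  apply/negP => eab; case: lc => _ _ /(_ [:: a; b]); rewrite c0 /= !inE !andbT.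
  rewrite eab sym eab; case: eqVneq eab => [->|_ _]; first by rewrite irr.
  by move=> /(_ isT isT).
have iT : indep e [set: T] by apply/indepP.
by have := tough_indep tG iT; rewrite cardsT; move: T3; card_lia.
Qed.

Lemma off_cycle_indep : indep e (~: C).
Proof.
apply/indepP => y z; rewrite !inE => yc zc.
exact: (component_single sym irr tG free lc yc longest_cycle_neq0 zc).
Qed.

(** The threshold balances two needs: two small neighbourhoods and [x |: nbr e x] miss over a
    twelfth of the vertices ([edge_far]), while a big vertex keeps over a third of them as
    neighbours on a path ([deg_in_path]). *)
Definition small v := 12 * #|nbr e v| < 5 * #|T|.

Section Vertex.
Variable x : T.
Hypothesis xc : x \notin c.

Lemma off_cycle_nbr y : e x y -> y \in c.
Proof.
move=> exy; apply/negPn/negP => yc; move: exy; apply/negP.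
by apply: (indep_in off_cycle_indep); rewrite !inE.
Qed.

Lemma nbr_attached y : e x y ->
  y \in [set a in c | [exists h in comp_of e C x, e a h]].
Proof.
move=> exy; rewrite inE off_cycle_nbr //=; apply/exists_inP; exists x.
  exact: comp_self.
by rewrite sym.
Qed.

Definition nexts := [set next c a | a in nbr e x].

Lemma card_nexts_nbr : #|nexts| = #|nbr e x|.
Proof. by rewrite card_imset //; exact: next_inj. Qed.

Lemma nexts_notin : x \notin nexts.
Proof.
apply/imsetP => -[y]; rewrite inE => /off_cycle_nbr yc xE.
by move: xc; rewrite xE mem_next yc.
Qed.

Lemma nexts_nbr w : w \in nexts -> ~~ e x w.
Proof.
case/imsetP=> a; rewrite inE => exa ->; apply/negP => exn.
have := next_attached sym lc (nbr_attached exa).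
by rewrite nbr_attached.
Qed.

Lemma nexts_indep_set : indep e nexts.
Proof.
apply: indepS (nexts_indep sym irr lc x); apply/subsetP => _ /imsetP[a xa ->].
by apply: imset_f; apply: nbr_attached; rewrite inE in xa.
Qed.

(** The empty set would separate an isolated [x], and toughness would read [22 <= 0]. *)
Lemma nbr_neq0 : nbr e x != set0.
Proof.
apply/eqP => nx0; have [u ux] : exists u, u \notin [set x].
  by apply: ex_notin; rewrite cards1; move: T3; card_lia.
have := tough_isolated sym tG (S := set0) (I := [set x]) (x := u).
rewrite cards0 cards1; move=> /(_ _ _ _ ux) h.
suff : 22 <= 0 by []; apply: h.
- apply/subsetP => y; rewrite inE => /exists_inP[v]; rewrite inE => /eqP->.
  by rewrite -nx0 inE.
- by rewrite disjoints_subset setC0 subsetT.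
- by rewrite inE.
- by apply/set0Pn; exists x; rewrite inE.
Qed.

Lemma deg_off_cycle : 12 * #|nbr e x|.+1 <= #|T|.
Proof.
rewrite -card_nexts_nbr; have := cardsU1 x nexts; rewrite nexts_notin add1n => <-.
apply: (tough_indep tG).
  by apply: (indepU1 sym irr nexts_indep_set) => w; apply: nexts_nbr.
by rewrite cardsU1 nexts_notin ltnS card_nexts_nbr card_gt0 nbr_neq0.
Qed.

Lemma off_cycle_small : small x.
Proof. by have := deg_off_cycle; rewrite /small; card_lia. Qed.

End Vertex.

(** * Small vertices and anticomplete sets *)

Variable x : T.
Hypothesis xc : x \notin c.

(** Otherwise [x |: A] would be an independent set exceeding a twelfth of the vertices. *)
Lemma edge_in A : A \subset ~: (x |: nbr e x) -> #|T| < 12 * #|A|.+1 ->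
  exists a b, [/\ a \in A, b \in A & e a b].
Proof.
move=> /subsetP sA lt; apply: not_indepP; apply/negP => iA.
have xA : x \notin A by apply/negP => /sA; rewrite !inE eqxx.
have := cardsU1 x A; rewrite xA => cA.
have := tough_indep tG (I := x |: A); rewrite cA; move: lt (deg_off_cycle xc).
have iU : indep e (x |: A).
  by apply: (indepU1 sym irr iA) => y /sA; rewrite !inE negb_or => /andP[].
by move=> l1 l2 /(_ iU); move: l1 l2; card_lia.
Qed.

(** With [n = #|T|], the excluded set has fewer than [5n/12 + 5n/12 + n/12] vertices. *)
Lemma edge_far u v : small u -> small v -> exists a b,
  [/\ e a b, a \notin nbr e u :|: nbr e v :|: (x |: nbr e x)
   & b \notin nbr e u :|: nbr e v :|: (x |: nbr e x)].
Proof.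
move=> su sv; set D := _ :|: _.
have [||a [b [aA bA eab]]] := @edge_in (~: D).
- by rewrite setCS subsetUr.
- have := cardsC D; have := cardsU (nbr e u :|: nbr e v) (x |: nbr e x).
  have := cardsU (nbr e u) (nbr e v); have := cardsU1 x (nbr e x).
  rewrite inE irr -/D; move: su sv (deg_off_cycle xc); rewrite /small; card_lia.
by exists a, b; move: aA bA; rewrite !in_setC.
Qed.

Lemma far_nonadj u v a : a \notin nbr e u :|: nbr e v :|: (x |: nbr e x) ->
  [/\ ~~ e u a, ~~ e v a & ~~ e x a].
Proof. by rewrite !inE !negb_or => /andP[/andP[-> ->] /andP[_ ->]]. Qed.

Lemma small_nonadj u v : small u -> small v -> ~~ e x u -> ~~ e x v -> ~~ e u v.
Proof.
move=> su sv xu xv; apply/negP => euv.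
have [a [b [eab /far_nonadj[ua va xa] /far_nonadj[ub vb xb]]]] := edge_far su sv.
by apply: (free_no_2P2_P1 sym irr free euv eab ua ub va vb (f := x)); rewrite sym.
Qed.

Lemma small_adj u v : small u -> small v -> e x u -> ~~ e x v -> e u v.
Proof.
move=> su sv xu xv; apply/negPn/negP => euv.
have [a [b [eab /far_nonadj[ua va xa] /far_nonadj[ub vb xb]]]] := edge_far su sv.
by apply: (free_no_2P2_P1 sym irr free xu eab xa xb ua ub (f := v)) => //; rewrite sym.
Qed.

(** Removing [x |: nbr e x] costs at most a twelfth of the vertices, so each set still contains an
    edge by [edge_in]; the two edges and [x] form the forbidden subgraph. *)
Lemma anticomplete A B : #|T| <= 6 * #|A| -> #|T| <= 6 * #|B| ->
  {in A & B, forall a b, ~~ e a b} -> False.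
Proof.
move=> lA lB AB; pose N := x |: nbr e x.
have big (D : {set T}) : #|T| <= 6 * #|D| -> exists a b, [/\ a \in D :\: N, b \in D :\: N & e a b].
  move=> lD; apply: edge_in; first by rewrite setDE subsetIr.
  have := cardsD D N; have := subset_leq_card (subsetIr D N).
  have := cardsU1 x (nbr e x); rewrite inE irr -/N.
  by move: lD (deg_off_cycle xc); card_lia.
have [a [b [aA bA eab]]] := big _ lA; have [d [f [dB fB edf]]] := big _ lB.
have far (D : {set T}) y : y \in D :\: N -> y \in D /\ ~~ e y x.
  by rewrite in_setD in_setU1 !inE negb_or sym => /andP[/andP[_ ->] ->].
have [[aA' ax] [bA' bx]] := (far _ _ aA, far _ _ bA).
have [[dB' dx] [fB' fx]] := (far _ _ dB, far _ _ fB).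
exact: (free_no_2P2_P1 sym irr free eab edf (AB _ _ aA' dB') (AB _ _ aA' fB')
  (AB _ _ bA' dB') (AB _ _ bA' fB') ax bx dx fx).
Qed.

Lemma no_spanning_cycle s : perm_eq s (x :: c) -> ~~ cycle e s.
Proof.
move=> pe; apply/negP; apply: (longest_cycle_extend (r := [:: x]) lc) => //.
  by move=> y; rewrite inE => /eqP->.
by rewrite (permPl pe) -cat1s perm_catC.
Qed.

(** * Spanning paths of [x :: c] with two big ends *)

Section Endpoints.
Variable p : seq T.
Hypotheses (pe : perm_eq p (x :: c)) (sp : sorted e p).

Let Up : uniq p. Proof. by rewrite (perm_uniq pe) /= xc. Qed.
Let pN : p != [::]. Proof. by rewrite -size_eq0 (perm_size pe). Qed.

Lemma endpoints_nonadj : ~~ e (head x p) (last x p).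
Proof.
by have := no_spanning_cycle pe; rewrite (cycle_link e x pN) sp sym.
Qed.

(** Vertices off [p] lie in the independent set [~: C] minus [x], so with [n = #|T|] at most
    [n/12 - 1] of the [5n/12] neighbours are lost. *)
Lemma deg_in_path v : ~~ small v -> 4 * #|T| + 12 <= 12 * count (e v) p.
Proof.
have -> : count (e v) p = #|nbr e v :&: [set y in p]|.
  rewrite -size_filter -(card_uniqP (filter_uniq _ Up)) -cardsE.
  by apply: eq_card => y; rewrite !inE mem_filter.
have sub : nbr e v \subset (nbr e v :&: [set y in p]) :|: (~: C :\ x).
  apply/subsetP => y; rewrite !inE (perm_mem pe) inE => ->.
  by case: eqVneq; case: (y \in c).
have := subset_leq_card sub; have := cardsU (nbr e v :&: [set y in p]) (~: C :\ x).
have := cardsD1 x (~: C); rewrite !inE xc.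
have := tough_indep tG off_cycle_indep; rewrite /small.
move: (deg_off_cycle xc); card_lia.
Qed.

Lemma three_pieces s t r : p = s ++ t ++ r -> s != [::] -> t != [::] -> r != [::] ->
  [/\ sorted e s, sorted e t, sorted e r, head x p = head x s & last x p = last x r].
Proof.
move=> pE s0 t0 r0; have tr : t ++ r != [::] by case: (t) t0.
move: sp; rewrite pE !(sorted_cat_link e x) // => /and3P[-> _ /and3P[-> _ ->]].
by split=> //; [case: (s) s0 | rewrite catA last_cat; case: (r) r0].
Qed.

(** Otherwise [rev s ++ t ++ rev r] is a spanning cycle. *)
Lemma early_late_nonadj s t r : p = s ++ t ++ r -> s != [::] -> t != [::] -> r != [::] ->
  e (head x p) (head x t) -> e (last x p) (last x t) -> ~~ e (last x s) (head x r).
Proof.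
move=> pE s0 t0 r0; have [ss st sr -> ->] := three_pieces pE s0 t0 r0 => eh el.
have pe' : perm_eq (rev s ++ t ++ rev r) (x :: c).
  apply: perm_trans pe; rewrite pE; apply: perm_cat; first by rewrite perm_rev.
  by rewrite perm_cat2l perm_rev.
have := no_spanning_cycle pe'.
rewrite (cycle_cat3 e x) ?rev_nilN // !sorted_rev_sym // ss st sr.
by rewrite !(head_rev, last_rev) eh sym el sym.
Qed.

(** Otherwise [s ++ rev t ++ rev r] is a spanning cycle. *)
Lemma late_early_nonadj s t r : p = s ++ t ++ r -> s != [::] -> t != [::] -> r != [::] ->
  e (head x p) (head x r) -> e (last x p) (head x t) -> ~~ e (last x s) (last x t).
Proof.
move=> pE s0 t0 r0; have [ss st sr -> ->] := three_pieces pE s0 t0 r0 => eh el.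
have pe' : perm_eq (s ++ rev t ++ rev r) (x :: c).
  apply: perm_trans pe; rewrite pE perm_cat2l; apply: perm_cat; by rewrite perm_rev.
have := no_spanning_cycle pe'.
rewrite (cycle_cat3 e x) ?rev_nilN // !sorted_rev_sym // ss st sr.
by rewrite !(head_rev, last_rev) sym [e (head x r) _]sym eh [e (head x t) _]sym el sym /= andbT.
Qed.

(** The slack [12] absorbs the rounding in [m./2]. *)
Lemma half_split (m n k d : nat) : 4 * n + 12 <= 12 * m -> k = m./2 -> m = k + d ->
  n <= 6 * k /\ n <= 6 * d.
Proof. by have := odd_double_half m; rewrite -addnn; case: odd; lia. Qed.

Lemma half_or (m n k d : nat) : 4 * n + 12 <= 12 * m -> m = k + d ->
  n <= 6 * k \/ n <= 6 * d.
Proof. lia. Qed.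

Let N a s : {set T} := [set v | (v \in s) && e a v].

Lemma card_nbr_seq a s : uniq s -> #|N a s| = count (e a) s.
Proof.
move=> us; rewrite -size_filter -(card_uniqP (filter_uniq _ us)) -[RHS]cardsE.
by apply: eq_card => y; rewrite !inE mem_filter andbC.
Qed.

Lemma prev_last s v t : p = s ++ v :: t -> s != [::] -> prev p v = last x s.
Proof.
case/lastP: s => // s u pE _; rewrite last_rcons.
by move: Up; rewrite pE cat_rcons => /prev_cons_cat.
Qed.

(** The path is cut where half of the neighbours of [h] have been met; [l] has enough neighbours on
    one side. Shifting neighbours along the path then gives two sets for [anticomplete]. *)
Lemma big_endpoints : ~~ small (head x p) -> ~~ small (last x p) -> False.
Proof.
set h := head x p; set l := last x p => bh bl.
have dh := deg_in_path bh; have dl := deg_in_path bl.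
have hl : ~~ e h l := endpoints_nonadj.
have hm m : m./2 <= m by rewrite -{2}[m]odd_double_half -addnn addnCA leq_addr.
have [i Ei] := @count_split _ (e h) p (count (e h) p)./2 (hm _).
have Et : take i p ++ drop i p = p := cat_take_drop i p.
have [Ut Ud] : uniq (take i p) /\ uniq (drop i p) by rewrite take_uniq // drop_uniq.
have ch : count (e h) p = count (e h) (take i p) + count (e h) (drop i p).
  by rewrite -count_cat Et.
have cl : count (e l) p = count (e l) (take i p) + count (e l) (drop i p).
  by rewrite -count_cat Et.
have [th th'] := half_split dh Ei ch.
have [tl|tl] := half_or dl cl.
(* Neighbours of [l] precede those of [h]: predecessors on both sides. *)
- apply: (@anticomplete (prev p @: N l (take i p)) (prev p @: N h (drop i p))).
  + by rewrite card_imset ?card_nbr_seq //; exact: prev_inj.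
  + by rewrite card_imset ?card_nbr_seq //; exact: prev_inj.
  move=> _ _ /imsetP[v + ->] /imsetP[w + ->]; rewrite !inE => /andP[vt ev] /andP[wd ew].
  have vh : v != h by apply: contraTneq ev => ->; rewrite sym.
  case/splitPr: vt Et => s1 s2; case/splitPr: wd => t1 t2 Et.
  have s1N : s1 != [::].
    by apply: contraNneq vh => s10; rewrite /h -Et s10.
  have pE : p = s1 ++ (v :: s2 ++ t1) ++ (w :: t2) by rewrite -Et -!catA /= -?catA.
  rewrite (prev_last pE) // (prev_last (s := s1 ++ (v :: s2 ++ t1)) (t := t2));
    rewrite ?pE -?catA //; last by case: (s1).
  by rewrite last_cat; apply: (late_early_nonadj pE).
(* Neighbours of [h] come first: their predecessors against successors of neighbours of [l]. *)
- apply: (@anticomplete (prev p @: N h (take i p)) (next p @: N l (drop i p))).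
  + by rewrite card_imset ?card_nbr_seq //; exact: prev_inj.
  + by rewrite card_imset ?card_nbr_seq //; exact: next_inj.
  move=> _ _ /imsetP[v + ->] /imsetP[w + ->]; rewrite !inE => /andP[vt ev] /andP[wd ew].
  have vh : v != h by apply: contraTneq ev => ->; rewrite irr.
  have wl : w != l by apply: contraTneq ew => ->; rewrite irr.
  case/splitPr: vt Et => s1 s2; case/splitPr: wd => t1 t2 Et.
  have s1N : s1 != [::].
    by apply: contraNneq vh => s10; rewrite /h -Et s10.
  case: t2 Et => [|u t2] Et.
    by move: wl; rewrite /l -Et !catA last_cat eqxx.
  have pE : p = s1 ++ (v :: s2 ++ t1 ++ [:: w]) ++ (u :: t2).
    by rewrite -Et -!catA /= -?catA.
  have -> : next p w = u.
    by move: Up; rewrite -Et catA => /next_cons_cat.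
  rewrite (prev_last pE) //; apply: (early_late_nonadj pE) => //.
  by rewrite /= catA last_cat.
Qed.

End Endpoints.

(** * Rotating spanning paths *)

Definition small_far : {set T} := [set v | small v && ~~ e x v].

Lemma small_far_indep : indep e small_far.
Proof.
apply/indepP => u v; rewrite !inE => /andP[su xu] /andP[sv xv].
exact: small_nonadj.
Qed.

Lemma off_cycle_small_far z : z \notin c -> z \in small_far.
Proof.
move=> zc; rewrite inE off_cycle_small //=.
by apply: (indep_in off_cycle_indep); rewrite !inE.
Qed.

Lemma nbrs_small_far A : A \subset small_far -> nbrs e A \subset C.
Proof.
move=> /subsetP sA; apply/subsetP => y; rewrite !inE => /exists_inP[a /sA aS eay].
apply/negPn/negP => /off_cycle_small_far yS; move: eay; apply/negP.
exact: (indep_in small_far_indep).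
Qed.

Definition spanning_path p := perm_eq p (x :: c) /\ sorted e p.

Lemma spanning_path_uniq p : spanning_path p -> uniq p.
Proof. by case=> pe _; rewrite (perm_uniq pe) /= xc. Qed.

Lemma spanning_path_neq0 p : spanning_path p -> p != [::].
Proof. by case=> pe _; rewrite -size_eq0 (perm_size pe). Qed.

Lemma spanning_path_rev p : spanning_path p -> spanning_path (rev p).
Proof. by move=> [pe sp]; split; rewrite ?sorted_rev_sym ?(perm_trans _ pe) ?perm_rev. Qed.

Lemma spanning_rotation p q : spanning_path p -> rotation e x p q ->
  spanning_path q /\ head x q = head x p.
Proof.
move=> sp rq; have [pe ss hd] := rotationP sym sp.2 rq.
by split=> //; split=> //; apply: perm_trans sp.1.
Qed.

Lemma rotation_ends_small p a : spanning_path p -> ~~ small (head x p) ->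
  a \in rotation_ends e x p -> small a.
Proof.
move=> sp bh /rotation_endsP[q rq <-]; apply/negPn/negP => bl.
have [[pe ss] hd] := spanning_rotation sp rq.
by apply: (big_endpoints pe ss) bl; rewrite hd.
Qed.

(** All neighbours of the independent set [D] lie on [p], so toughness and Posa's bound give [11 *
    #|D| <= 3 * #|rotation_ends e x p| <= 6 * #|D|]. *)
Lemma few_rotation_ends p (D : {set T}) : spanning_path p -> D != set0 ->
  D \subset rotation_ends e x p :&: small_far ->
  #|rotation_ends e x p| <= 2 * #|D| -> False.
Proof.
move=> sp D0 sD leD; have := sD; rewrite subsetI => /andP[DE DS].
have iD : indep e D := indepS DS small_far_indep.
(* For a singleton [D] this comes from [deg_off_cycle]. *)
have h12 : 12 * #|D| <= #|T|.
  have := tough_indep tG iD; move: (deg_off_cycle xc); rewrite mulnS.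
  by card_lia.
have h11 := tough_nbrs sym tG iD D0 h12.
have sub : nbrs e D \subset nbrs e (rotation_ends e x p) :&: [set y in p].
  apply/subsetP => y yD; rewrite in_setI; apply/andP; split.
    move: yD; rewrite !inE => /exists_inP[a aD eay]; apply/exists_inP; exists a => //.
    exact: (subsetP DE).
  have := subsetP (nbrs_small_far DS) _ yD.
  by rewrite !inE (perm_mem sp.1) inE => ->; rewrite orbT.
have := subset_leq_card sub.
have := rotation_ends_nbrs x sym (spanning_path_neq0 sp) (spanning_path_uniq sp) sp.2.
move: D0 leD h11; rewrite -card_gt0; card_lia.
Qed.

(** [c] is cut after [a] and [x] is appended, so only [a] and [next c a] cease to be consecutive. *)
Lemma path_through a : e x a -> exists p,
  [/\ spanning_path p, head x p = next c a, last x p = x &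
      forall b, b \in c -> b != a -> exists s1 s2, p = s1 ++ b :: next c b :: s2].
Proof.
move=> exa; have ac := off_cycle_nbr xc exa.
have [i t E] := rot_to ac.
have E1 : rot 1 (rot i c) = rcons t a by rewrite E rot1_cons.
have nx y : next (rcons t a) y = next c y by rewrite -E1 !next_rot ?rot_uniq.
have Ut : uniq (rcons t a) by rewrite -E1 !rot_uniq.
have tN : rcons t a != [::] by case: (t).
have : cycle e (rcons t a) by rewrite -E1 !rot_cycle; case: lc.
rewrite (cycle_link e x tN) => /andP[st _].
exists (rcons (rcons t a) x); split.
- split; last first.
    by rewrite -cats1 (sorted_cat_link e x) //= st last_rcons sym exa.
  by rewrite perm_rcons perm_cons -E1 !perm_rot.
- have := prev_head x Ut; rewrite last_rcons => pa.
  by rewrite -nx -[X in next _ X]pa next_prev //; case: (t).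
- by rewrite last_rcons.
- move=> b; rewrite -(mem_rot i) E inE => /orP[->//|bt] _.
  case/splitPr: bt E1 nx Ut => s1 s2 E1 nx Ut.
  have [z [s3 sE]] : exists z s3, rcons s2 a = z :: s3.
    by case: (s2) => [|z s3]; [exists a, [::] | exists z, (rcons s3 a)].
  exists s1, (rcons s3 x); rewrite -nx !rcons_cat !rcons_cons sE.
  by move: Ut; rewrite rcons_cat rcons_cons sE => /next_cons_cat->.
Qed.

(** A path starting at [x] is rotated. Its ends are never adjacent to [x], or a spanning cycle would
    arise; if all were small, [few_rotation_ends] would apply. *)
Lemma ex_big_start : exists2 p, spanning_path p & ~~ small (head x p).
Proof.
have [a] := set0Pn _ (nbr_neq0 x); rewrite inE => /path_through[p [sp hp lp _]].
have sr := spanning_path_rev sp.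
case: (pselect (exists2 u, u \in rotation_ends e x (rev p) & ~~ small u)) => [[u]|nb].
  move=> /rotation_endsP[q rq lq] bu; have [sq hq] := spanning_rotation sr rq.
  by exists (rev q); rewrite ?head_rev ?lq //; exact: spanning_path_rev.
exfalso; apply: (few_rotation_ends sr (D := rotation_ends e x (rev p))).
- apply/set0Pn; exists (last x (rev p)); apply: mem_rotation_ends.
  exact: rotation_refl.
- rewrite subsetI subxx; apply/subsetP => u uE; rewrite inE; apply/andP; split.
    by apply/negPn/negP => bu; apply: nb; exists u.
  have [q rq <-] := rotation_endsP uE; have [[pe ss] hq] := spanning_rotation sr rq.
  by have := endpoints_nonadj pe ss; rewrite hq head_rev lp.
- by card_lia.
Qed.

(** Some end [a] is adjacent to [x], by [few_rotation_ends], hence to all of [small_far]. On a path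
    ending at [a], successors of [small_far] vertices are then ends, so small, so adjacent to [x] by
    [small_nonadj]. *)
Lemma small_far_card p : spanning_path p -> ~~ small (head x p) ->
  #|small_far :&: [set y in p]| <= #|nbr e x|.
Proof.
move=> sp bh.
case: (pselect (exists2 a, a \in rotation_ends e x p & e x a)) => [[a aE exa]|na]; last first.
  exfalso; apply: (few_rotation_ends sp (D := rotation_ends e x p)).
  - apply/set0Pn; exists (last x p); apply: mem_rotation_ends.
    exact: rotation_refl.
  - rewrite subsetI subxx; apply/subsetP => u uE; rewrite inE.
    rewrite (rotation_ends_small sp bh uE); apply/negP => xu.
    by apply: na; exists u.
  - by card_lia.
have sa := rotation_ends_small sp bh aE.
have [q rq lq] := rotation_endsP aE; have [sq hq] := spanning_rotation sp rq.
have Uq := spanning_path_uniq sq.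
rewrite -(card_imset _ (next_inj Uq)); apply/subset_leq_card/subsetP.
move=> _ /imsetP[s + ->]; rewrite !inE => /andP[/andP[ss xs] sp'].
have sq' : s \in q by rewrite (perm_mem sq.1) -(perm_mem sp.1).
have sa' : s != a by apply: contraNneq xs => ->.
have eas := small_adj sa ss exa xs.
case/splitPr: sq' rq lq sq Uq {hq} => s1 [|z s2] rq lq sq Uq.
  by move: sa'; rewrite -lq last_cat eqxx.
rewrite (next_cons_cat Uq).
have zE : z \in rotation_ends e x p.
  by apply: (rotation_ends_succ rq (erefl _)); rewrite lq sym.
have sz := rotation_ends_small sp bh zE.
have esz : e s z.
  have := sq.2; case: (s1) => [|y s3] /=; first by case/andP.
  by rewrite cat_path /= => /and3P[_ _ /andP[]].
apply/negPn/negP => xz; move/negP: (small_nonadj ss sz xs xz); exact.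
Qed.

Lemma off_cycle_contradiction : False.
Proof.
case: (pselect (exists2 a, e x a & ~~ small (next c a))) => [[a exa bn]|ns].
  have [p [sp hp lp sub]] := path_through exa.
  have bh : ~~ small (head x p) by rewrite hp.
  pose D := rotation_ends e x p :&: small_far.
  have xD : x |: (nexts x :\ next c a) \subset D.
    have xE : x \in rotation_ends e x p.
      by rewrite -[x in x \in _]lp; apply: mem_rotation_ends; exact: rotation_refl.
    apply/subsetP => u; rewrite in_setU1 => /orP[/eqP->|].
      by rewrite in_setI xE off_cycle_small_far.
    rewrite in_setD1 => /andP[ua un]; rewrite in_setI [u \in small_far]inE nexts_nbr // andbT.
    suff uE : u \in rotation_ends e x p by rewrite uE (rotation_ends_small sp bh uE).
    case/imsetP: un ua => b; rewrite inE => exb -> nba.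
    have ba : b != a by apply: contraNneq nba => ->.
    have [s1 [s2 E]] := sub b (off_cycle_nbr xc exb) ba.
    by apply: (rotation_ends_succ (rotation_refl e x p) E); rewrite lp sym.
  (* [x] makes up for the removed big vertex [next c a]. *)
  have cD : #|nbr e x| <= #|D|.
    apply: leq_trans (subset_leq_card xD).
    rewrite cardsU1 in_setD1 (negPf (nexts_notin xc)) andbF -card_nexts_nbr.
    rewrite [in X in X <= _](cardsD1 (next c a)) imset_f //.
    by rewrite inE.
  apply: (few_rotation_ends sp (D := D)) => //.
    by apply/set0Pn; exists x; apply: (subsetP xD); exact: setU11.
  (* All ends are small, so those outside [D] are neighbours of [x]: at most [2 * #|D|] ends. *)
  have : rotation_ends e x p \subset D :|: nbr e x.
    apply/subsetP => u uE; rewrite in_setU in_setI uE [u \in small_far]inE.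
    by rewrite (rotation_ends_small sp bh uE) [u \in nbr _ _]inE; case: (e x u).
  move/subset_leq_card; have := cardsU D (nbr e x); move: cD; card_lia.
(* All successors are small here; with [x] they put one vertex too many into [small_far] on [p]. *)
have [p sp bh] := ex_big_start.
have := small_far_card sp bh; rewrite leqNgt => /negP; apply.
have <- : #|x |: nexts x| = #|nbr e x|.+1 by rewrite cardsU1 (nexts_notin xc) card_nexts_nbr.
apply/subset_leq_card/subsetP => u; rewrite in_setU1 in_setI => /orP[/eqP->|un].
  by rewrite off_cycle_small_far // inE (perm_mem sp.1) mem_head.
rewrite [u \in small_far]inE nexts_nbr // andbT; case/imsetP: un => a; rewrite [a \in _]inE => exa ->.
have -> : small (next c a) by apply/negPn/negP => ?; apply: ns; exists a.
by rewrite !inE (perm_mem sp.1) inE mem_next (off_cycle_nbr xc exa) ?orbT.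
Qed.

End LowDegree.

Theorem theorem1p2 (T : finType) (e : rel T) :
  simple_graph e -> 3 <= #|T| -> tough e 11 -> free_2P2_P1 e -> hamiltonian e.
Proof.
move=> [sym irr] T3 tG free; have [c lc] := ex_longest_cycle e.
have [Uc cc _] := lc; exists c; split=> // x; apply/negPn/negP => xc.
exact: (off_cycle_contradiction sym irr tG free T3 lc xc).
Qed.
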